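(* Let $S$ be a group and let $\psi\colon X\to X'$ be a morphism of $S$-axets. There is a bijection between the set of complete subaxets of $X$ (complete with respect to $\psi$) and the set of subaxets of $\operatorname{im}\psi$.
   Context: Actions are right actions. An $S$-axet $(G,X,\tau)$ consists of a group $G$, a $G$-set $X$ and a map $\tau\colon X\times S\to G$, written $\tau_x(s)$, such that for all $x\in X$, $s,s'\in S$, $g\in G$: $\tau_x(s)\in G_x$; $\tau_x(ss')=\tau_x(s)\tau_x(s')$; $\tau_{xg}(s)=g^{-1}\tau_x(s)g$. A subset $Y\subseteq X$ is closed if it is invariant under $\tau_y(s)$ for all $y\in Y,s\in S$; a subaxet is $(H,Y,\sigma)$ with $Y$ closed, $H$ the setwise stabiliser of $Y$ in $G$ and $\sigma=\tau|_{Y\times S}$ (so subaxets correspond to closed subsets). A morphism $(G,X,\tau)\to(G',X',\tau')$ is a map of sets $\psi\colon X\to X'$ with $\psi(y\tau_x(s))=\psi(y)\tau'_{\psi(x)}(s)$ for all $x,y\in X$, $s\in S$; its image is a subaxet of $X'$. A subaxet $Y$ of $X$ is complete with respect to $\psi$ if for every $y\in Y$ the whole class $\{x\in X:\psi(x)=\psi(y)\}$ is contained in $Y$. *)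

(* Defs.v *)
From HB Require Import structures.
From mathcomp Require Import all_boot.
From mathcomp Require Import boolp classical_sets functions.

Set Implicit Arguments.
Unset Strict Implicit.
Unset Printing Implicit Defensive.

Local Open Scope group_scope.
Local Open Scope classical_set_scope.

(* Right G-sets for an arbitrary group; the actions of mathcomp.fingroup are
   restricted to finite groups. *)
Record gset (G : groupType) := GSet {
  gset_sort :> Type;
  gact : gset_sort -> G -> gset_sort;
  gact1 : forall x, gact x 1 = x;
  gactM : forall x g h, gact x (g * h) = gact (gact x g) h }.

Definition point_stab (G : groupType) (X : gset G) (x : X) : set G :=
  [set g | gact x g = x].

Definition setwise_stab (G : groupType) (X : gset G) (Y : set X) : set G :=
  [set g | [set gact y g | y in Y] = Y].

Record axet (S : groupType) := Axet {
  axet_group : groupType;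
  axet_gset :> gset axet_group;
  tau : axet_gset -> S -> axet_group;
  tau_stab : forall x s, point_stab x (tau x s);
  tauM : forall x s s', tau x (s * s') = tau x s * tau x s';
  tauJ : forall x s g, tau (gact x g) s = g^-1 * tau x s * g }.

Section SetwiseStabiliser.
Variables (G : groupType) (X : gset G) (Y : set X).

Lemma setwise_stabP g :
  setwise_stab Y g <->
  (forall y, Y y -> Y (gact y g)) /\ (forall y, Y y -> Y (gact y g^-1)).
Proof.
split=> [gY|[gY gVY]].
  split=> y Yy; first by rewrite -gY; exists y.
  by move: Yy; rewrite -{1}gY => -[z Yz <-]; rewrite -gactM mulgV gact1.
apply/seteqP; split=> [_ [y Yy <-]|y Yy]; first exact: gY.
by exists (gact y g^-1); [exact: gVY|rewrite -gactM mulVg gact1].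
Qed.

Lemma setwise_stab_group_closed : group_closed (mem (setwise_stab Y)).
Proof.
split=> [|g h]; rewrite !inE.
  by apply/setwise_stabP; split=> y; rewrite ?invg1 gact1.
move=> /setwise_stabP[gY gVY] /setwise_stabP[hY hVY].
by apply/setwise_stabP; split=> y Yy; rewrite ?invgM ?invgK gactM; auto.
Qed.

Definition stab_group : Type := set_type (setwise_stab Y).
HB.instance Definition _ := SubChoice.on stab_group.
HB.instance Definition _ :=
  SubChoice_isSubGroup.Build G _ stab_group setwise_stab_group_closed.

Lemma stab_act_subproof (y : Y) (g : stab_group) :
  gact (val y) (val g) \in Y.
Proof.
have /set_mem/setwise_stabP[gY _] := valP g.
exact/mem_set/gY/set_mem/(valP y).
Qed.

Definition stab_act (y : Y) (g : stab_group) : Y :=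
  exist _ (gact (val y) (val g)) (stab_act_subproof y g).

Lemma stab_act1 y : stab_act y 1 = y.
Proof. by apply: val_inj; rewrite /= gact1. Qed.

Lemma stab_actM y g h : stab_act y (g * h) = stab_act (stab_act y g) h.
Proof. by apply: val_inj; rewrite /= gactM. Qed.

Definition stab_gset : gset stab_group := GSet stab_act1 stab_actM.

End SetwiseStabiliser.

Section Subaxets.
Variables (S : groupType) (X : axet S).

Definition axet_closed (Y : set X) : Prop :=
  forall y s, Y y -> forall z, Y z -> Y (gact z (tau y s)).

(* A subaxet (H, Y, sigma) is determined by Y; the group H and the map sigma
   are recovered by the coercion axet_of_subaxet below. *)
Record subaxet := Subaxet {
  subaxet_set : set X;
  subaxet_closed : axet_closed subaxet_set }.

Variable Y : subaxet.
Let H := stab_group (subaxet_set Y).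

Lemma tau1 (x : X) : tau x 1 = 1.
Proof. by apply: (mulgI (tau x 1)); rewrite -tauM !mulg1. Qed.

Lemma tauV (x : X) s : tau x s^-1 = (tau x s)^-1.
Proof. by apply: (mulgI (tau x s)); rewrite -tauM !mulgV tau1. Qed.

Lemma sub_tau_subproof (y : subaxet_set Y) s :
  tau (val y) s \in setwise_stab (subaxet_set Y).
Proof.
have Yy := set_mem (valP y).
apply/mem_set/setwise_stabP; split=> z Yz; rewrite -?tauV;
  exact: subaxet_closed.
Qed.

Definition sub_tau (y : stab_gset (subaxet_set Y)) (s : S) : H :=
  exist _ (tau (val y) s) (sub_tau_subproof y s).

Lemma sub_tau_stab y s : point_stab y (sub_tau y s).
Proof. by apply: val_inj; exact: tau_stab. Qed.

Lemma sub_tauM y s s' : sub_tau y (s * s') = sub_tau y s * sub_tau y s'.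
Proof. by apply: val_inj; rewrite /= tauM. Qed.

Lemma sub_tauJ y s g : sub_tau (gact y g) s = g^-1 * sub_tau y s * g.
Proof. by apply: val_inj; rewrite /= tauJ. Qed.

Definition axet_of_subaxet : axet S := Axet sub_tau_stab sub_tauM sub_tauJ.

End Subaxets.

Coercion axet_of_subaxet : subaxet >-> axet.

(* No group homomorphism is part of a morphism of axets. *)
Record axet_morphism (S : groupType) (X X' : axet S) := AxetMorphism {
  axet_fun :> X -> X';
  axet_funP : forall x y s,
    axet_fun (gact y (tau x s)) = gact (axet_fun y) (tau (axet_fun x) s) }.

Section MorphismImage.
Variables (S : groupType) (X X' : axet S) (psi : axet_morphism X X').

Lemma axet_closed_range : axet_closed (range psi).
Proof.
by move=> _ s [x _ <-] _ [y _ <-]; exists (gact y (tau x s)); rewrite ?axet_funP.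
Qed.

Definition axet_image : subaxet X' := Subaxet axet_closed_range.

Definition complete (Y : subaxet X) : Prop :=
  forall y, subaxet_set Y y -> [set x | psi x = psi y] `<=` subaxet_set Y.

End MorphismImage.

(* Main.v *)
Require Import Defs.
From mathcomp Require Import all_boot.
From mathcomp Require Import boolp classical_sets functions.

(** This is the correspondence theorem for axets.  A morphism carries closed
    subsets to closed subsets in both directions, by image
    ([subaxet_direct_image]) and by preimage ([subaxet_preimage]), because
    [y tau_x(s)] is sent to [psi(y) tau'_{psi(x)}(s)].  Regard [psi] as a
    surjective morphism onto the axet [axet_image psi] ([corestriction]).
    Surjectivity makes the image of the preimage of [Z] equal to [Z]; and a
    subaxet is complete exactly when it is a union of fibres of [psi], that is,
    when it is the preimage of its image.  So [Y |-> psi(Y)] is a bijection from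
    the complete subaxets onto the subaxets of the image, and its inverse is
    the preimage. *)

Set Implicit Arguments.
Unset Strict Implicit.
Unset Printing Implicit Defensive.

Local Open Scope classical_set_scope.

Lemma subaxet_ext (S : groupType) (X : axet S) (Y Z : subaxet X) :
  subaxet_set Y = subaxet_set Z -> Y = Z.
Proof.
case: Y Z => [Y cY] [Z cZ] /= YZ; subst Z.
by rewrite (Prop_irrelevance cY cZ).
Qed.

Section ImageAndPreimage.
Variables (S : groupType) (X W : axet S) (phi : axet_morphism X W).

Lemma axet_closed_direct_image (Y : subaxet X) :
  axet_closed (phi @` subaxet_set Y).
Proof.
move=> _ s [x Yx <-] _ [y Yy <-]; exists (gact y (tau x s)).
  exact: subaxet_closed.
exact: axet_funP.
Qed.

Definition subaxet_direct_image (Y : subaxet X) : subaxet W :=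
  Subaxet (@axet_closed_direct_image Y).

Lemma axet_closed_preimage (Z : subaxet W) :
  axet_closed (phi @^-1` subaxet_set Z).
Proof.
by move=> x s Zx y Zy; rewrite /preimage /= axet_funP; exact: subaxet_closed.
Qed.

Definition subaxet_preimage (Z : subaxet W) : subaxet X :=
  Subaxet (@axet_closed_preimage Z).

Lemma complete_preimage (Z : subaxet W) : complete phi (subaxet_preimage Z).
Proof. by move=> y Zy x /= phixy; rewrite /preimage /= phixy. Qed.

Lemma preimage_direct_image (Y : subaxet X) :
  complete phi Y -> subaxet_preimage (subaxet_direct_image Y) = Y.
Proof.
move=> cY; apply: subaxet_ext; apply/seteqP; split=> [x [y Yy phiyx]|x Yx].
  by apply: (cY y Yy) => /=.
by exists x.
Qed.

Lemma direct_image_preimage (Z : subaxet W) :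
  range phi = setT -> subaxet_direct_image (subaxet_preimage Z) = Z.
Proof.
move=> phi_surj; apply: subaxet_ext; apply/seteqP; split=> [_ [x Zx <-] //|w Zw].
have [x _ phix] : range phi w by rewrite phi_surj.
by exists x; rewrite //= /preimage /= phix.
Qed.

Lemma direct_image_bij : range phi = setT ->
  set_bij [set Y | complete phi Y] setT subaxet_direct_image.
Proof.
move=> phi_surj; split=> // [Y Z /set_mem cY /set_mem cZ YZ|Z _].
  by rewrite -(preimage_direct_image cY) YZ preimage_direct_image.
by exists (subaxet_preimage Z);
  [exact: complete_preimage|exact: direct_image_preimage].
Qed.

End ImageAndPreimage.

Section Corestriction.
Variables (S : groupType) (X X' : axet S) (psi : axet_morphism X X').

Definition corestriction_fun (x : X) : axet_image psi :=
  exist _ (psi x) (mem_set (imageT psi x)).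

Lemma corestriction_funP (x y : X) (s : S) :
  corestriction_fun (gact y (tau x s)) =
  gact (corestriction_fun y) (tau (corestriction_fun x) s).
Proof. by apply: val_inj; exact: axet_funP. Qed.

Definition corestriction : axet_morphism X (axet_image psi) :=
  AxetMorphism corestriction_funP.

Lemma range_corestriction : range corestriction = setT.
Proof.
apply/seteqP; split=> // w _; have [x _ psix] := set_mem (valP w).
by exists x => //; apply: val_inj.
Qed.

(** Corestricting does not change the fibres, and completeness depends only on
    the fibres. *)
Lemma complete_corestriction (Y : subaxet X) :
  complete corestriction Y <-> complete psi Y.
Proof.
split=> cY y Yy x /= xy; apply: (cY y Yy) => /=; first exact: val_inj.
exact: (congr1 val xy).
Qed.

End Corestriction.

Theorem theorem3p20 (S : groupType) (X X' : axet S)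
    (psi : axet_morphism X X') :
  exists f : subaxet X -> subaxet (axet_image psi),
    set_bij [set Y : subaxet X | complete psi Y]
            [set: subaxet (axet_image psi)] f.
Proof.
exists (subaxet_direct_image (corestriction psi)).
have -> : [set Y | complete psi Y] = [set Y | complete (corestriction psi) Y].
  by apply/seteqP; split=> Y /= /complete_corestriction.
exact/direct_image_bij/range_corestriction.
Qed.
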